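(* Any nonempty compact convex set $C\subset\mathbb{R}^2$ contains the midpoint of its interval hull.
   Context: An interval in $\mathbb{R}^n$ is a nonempty set of the form $\{x\in\mathbb{R}^n: a\le x\le b\}$ with $a,b\in\mathbb{R}^n$, the inequalities being componentwise. The midpoint of the interval $\{x\in\mathbb{R}^n:a\le x\le b\}$ is $\frac12(a+b)\in\mathbb{R}^n$. The interval hull of a bounded set $B\subset\mathbb{R}^n$ is the intersection in $\mathbb{R}^n$ of all intervals that are supersets of $B$. *)

(* Defs.v *)
From HB Require Import structures.
From mathcomp Require Import all_boot all_order all_algebra.
From mathcomp Require Import all_classical all_reals all_analysis.

Set Implicit Arguments.
Unset Strict Implicit.
Unset Printing Implicit Defensive.

Import Order.TTheory GRing.Theory Num.Theory.
Import numFieldNormedType.Exports.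

Local Open Scope classical_set_scope.
Local Open Scope ring_scope.

Definition rV_itv (R : realType) (n : nat) (a b : 'rV[R]_n) : set 'rV[R]_n :=
  [set x | forall i : 'I_n, a 0 i <= x 0 i <= b 0 i].

Definition is_rV_itv (R : realType) (n : nat) (I : set 'rV[R]_n) : Prop :=
  I !=set0 /\ exists a b : 'rV[R]_n, I = rV_itv a b.

Definition interval_hull (R : realType) (n : nat) (B : set 'rV[R]_n) :
    set 'rV[R]_n :=
  \bigcap_(I in [set I | is_rV_itv I /\ B `<=` I]) I.

(* The midpoint of an interval, as a relation that is only satisfiable when I
   is an interval; it is functional by is_midpoint_inj. *)
Definition is_midpoint (R : realType) (n : nat) (I : set 'rV[R]_n)
    (m : 'rV[R]_n) : Prop :=
  I !=set0 /\ exists a b : 'rV[R]_n, I = rV_itv a b /\ m = 2^-1 *: (a + b).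

Lemma rV_itv_endpoints (R : realType) (n : nat) (a b : 'rV[R]_n) :
  rV_itv a b !=set0 -> rV_itv a b a /\ rV_itv a b b.
Proof.
move=> [x xab]; have le_ab i : a 0 i <= b 0 i.
  by have /andP[ax xb] := xab i; exact: le_trans ax xb.
by split=> i; rewrite lexx le_ab.
Qed.

Lemma is_midpoint_inj (R : realType) (n : nat) (I : set 'rV[R]_n)
    (m m' : 'rV[R]_n) :
  is_midpoint I m -> is_midpoint I m' -> m = m'.
Proof.
move=> [I0 [a [b [Iab ->]]]] [_ [a' [b' [Iab' ->]]]].
have [Ia Ib] : I a /\ I b by rewrite Iab; apply: rV_itv_endpoints; rewrite -Iab.
have [Ia' Ib'] : I a' /\ I b'.
  by rewrite Iab'; apply: rV_itv_endpoints; rewrite -Iab'.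
move: Ia Ib Ia' Ib'; rewrite {1 2}Iab' Iab => Ia Ib Ia' Ib'.
congr (_ *: (_ + _)); apply/rowP => i; apply/le_anti.
  by have /andP[-> _] := Ia' i; have /andP[-> _] := Ia i.
by have /andP[_ ->] := Ib i; have /andP[_ ->] := Ib' i.
Qed.

(* Main.v *)
Require Import Defs.
From HB Require Import structures.
From mathcomp Require Import all_boot all_order all_algebra.
From mathcomp Require Import all_classical all_reals all_analysis.
From mathcomp Require Import ring lra.
Import Order.TTheory GRing.Theory Num.Theory.
Import numFieldNormedType.Exports.

Set Implicit Arguments.
Unset Strict Implicit.
Unset Printing Implicit Defensive.

Local Open Scope classical_set_scope.
Local Open Scope ring_scope.

(* C has a point on each of the four sides of its interval hull. Take the
   center of the hull as origin. If s lies on the upper side, then some w on the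
   left or the right side is not strictly on the same side of the vertical axis
   as s; weighting s and w by their distances to that axis yields a point of C on
   the upper half of the axis, because s dominates w both in height and in
   weight. Likewise C has a point on the lower half of the axis, and the segment
   between the two contains the center. *)

(** The weights are left unnormalized so that distances to a line can be used directly. *)
Lemma convex_set_mean (R : realType) (M : lmodType R) (C : set M) (x y : M)
    (u v : R) : convex_set (C : set (convex_lmodType M)) -> C x -> C y ->
  0 <= u -> 0 <= v -> 0 < u + v -> C ((u + v)^-1 *: (u *: x + v *: y)).
Proof.
move=> Cconv Cx Cy u0 v0 uv0.
have t0 : 0 <= u / (u + v) by rewrite divr_ge0// ltW.
have t1 : u / (u + v) <= 1 by rewrite ler_pdivrMr// mul1r lerDl.
have := Cconv x y (Itv01 t0 t1) (mem_set Cx) (mem_set Cy).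
rewrite inE /conv/=; congr (C _).
rewrite scalerDr !scalerA mulrC; congr (_ + _ *: _).
by rewrite /unstable.onem; field; exact: lt0r_neq0.
Qed.

Lemma mean_coordB (R : realType) (n : nat) (x y : 'rV[R]_n) (u v c : R)
    (k : 'I_n) : u + v != 0 ->
  ((u + v)^-1 *: (u *: x + v *: y)) 0 k - c =
  (u + v)^-1 * (u * (x 0 k - c) + v * (y 0 k - c)).
Proof. by move=> uv; rewrite !mxE; field. Qed.

Lemma mulr_norm_opp (R : realDomainType) (x y : R) :
  x * y <= 0 -> `|y| * x + `|x| * y = 0.
Proof.
by move=> xy0; case: (ger0P x) => x0; case: (ger0P y) => y0; nra.
Qed.

(** Weighting [s] by the distance of [w] to the hyperplane, and [w] by that of [s], cancels
    coordinate [i] since the two offsets have opposite signs. The sign of [e] selects the upper or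
    the lower half. *)
Lemma convex_axis_point (R : realType) (n : nat) (C : set 'rV[R]_n)
    (s w : 'rV[R]_n) (i j : 'I_n) (a b e : R) :
  convex_set (C : set (convex_lmodType 'rV[R]_n)) -> C s -> C w ->
  (s 0 i - a) * (w 0 i - a) <= 0 -> `|s 0 i - a| <= `|w 0 i - a| ->
  `|e * (w 0 j - b)| <= e * (s 0 j - b) ->
  exists z, [/\ C z, z 0 i = a & 0 <= e * (z 0 j - b)].
Proof.
move=> Cconv Cs Cw sw.
set u : R := `|w 0 i - a|; set v : R := `|s 0 i - a| => vu ws.
have sj0 : 0 <= e * (s 0 j - b) by exact: le_trans ws.
(* If [u = 0], both weights vanish, but then [s], being no farther than [w], already has [i]-th
   coordinate [a]. *)
have [u0|u0] := eqVneq u 0.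
  exists s; split=> //; apply/eqP; rewrite -subr_eq0 -normr_eq0.
  by rewrite eq_le normr_ge0 andbT -u0.
have up : 0 < u by rewrite lt_neqAle eq_sym u0 normr_ge0.
have vp : 0 <= v by rewrite normr_ge0.
have uvp : 0 < u + v by rewrite ltr_pwDl.
exists ((u + v)^-1 *: (u *: s + v *: w)); split.
- by apply: convex_set_mean => //; exact: ltW.
- apply/eqP; rewrite -subr_eq0 mean_coordB ?lt0r_neq0// mulf_eq0 orbC.
  apply/orP; left; apply/eqP; exact: mulr_norm_opp.
- rewrite mean_coordB ?lt0r_neq0// mulrCA mulr_ge0 ?invr_ge0 ?(ltW uvp)//.
  (* The sum is at least [(u - v) * (e * (s 0 j - b))], a product of nonnegative factors. *)
  by move: ws; rewrite ler_norml => /andP[ws _]; nra.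
Qed.

Lemma convex_between (R : realType) (n : nat) (C : set 'rV[R]_n)
    (x y m : 'rV[R]_n) (j : 'I_n) :
  convex_set (C : set (convex_lmodType 'rV[R]_n)) -> C x -> C y ->
  (forall k, k != j -> x 0 k = m 0 k) -> (forall k, k != j -> y 0 k = m 0 k) ->
  x 0 j <= m 0 j <= y 0 j -> C m.
Proof.
move=> Cconv Cx Cy xm ym /andP[xj yj].
(* Apart from this case, the weights [y 0 j - m 0 j] for [x] and [m 0 j - x 0 j] for [y] have a
   positive sum and mean [m]. *)
have [yj0|yj0] := eqVneq (y 0 j) (m 0 j).
  suff -> : m = y by [].
  by apply/rowP => k; have [->|/ym->] := eqVneq k j.
have yjp : 0 < y 0 j - m 0 j by rewrite subr_gt0 lt_neqAle eq_sym yj0.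
have xjp : 0 <= m 0 j - x 0 j by rewrite subr_ge0.
have uvp := ltr_pwDl yjp xjp.
have := convex_set_mean Cconv Cx Cy (ltW yjp) xjp uvp; congr (C _).
apply/rowP => k; apply/eqP; rewrite -subr_eq0 mean_coordB ?lt0r_neq0//.
rewrite mulf_eq0 orbC; apply/orP; left; apply/eqP.
have [->|kj] := eqVneq k j; first by ring.
by rewrite (xm k kj) (ym k kj) subrr !mulr0 addr0.
Qed.

Lemma compact_coord_bounds (R : realType) (n : nat) (C : set 'rV[R]_n) :
  C !=set0 -> compact C ->
  exists lo hi : 'I_n -> 'rV[R]_n, forall i, [/\ C (lo i), C (hi i) &
    forall x, C x -> lo i 0 i <= x 0 i <= hi i 0 i].
Proof.
move=> C0 Cc.
have cf i : {within C, continuous (fun x : 'rV[R]_n => x 0 i)}.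
  by apply: continuous_subspaceT => x; exact: coord_continuous.
suff /choice[f fP] : forall i, exists p : 'rV[R]_n * 'rV[R]_n,
    [/\ C p.1, C p.2 & forall x, C x -> p.1 0 i <= x 0 i <= p.2 0 i].
  by exists (fst \o f), (snd \o f).
move=> i; have [p + pmin] := EVT_min_rV C0 Cc (cf i).
have [q + qmax] := EVT_max_rV C0 Cc (cf i).
rewrite !inE => Cq Cp; exists (p, q); split=> // x Cx.
by rewrite pmin ?qmax ?inE.
Qed.

(** The box is itself an interval around [C]; conversely, any interval around [C] contains every
    [lo i] and [hi i], so its [i]-th bounds enclose those of the box. *)
Lemma interval_hullE (R : realType) (n : nat) (C : set 'rV[R]_n)
    (lo hi : 'I_n -> 'rV[R]_n) : C !=set0 ->
  (forall i, [/\ C (lo i), C (hi i) &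
    forall x, C x -> lo i 0 i <= x 0 i <= hi i 0 i]) ->
  interval_hull C = rV_itv (\row_i lo i 0 i) (\row_i hi i 0 i).
Proof.
move=> [x0 Cx0] lohi.
have Csub : C `<=` rV_itv (\row_i lo i 0 i) (\row_i hi i 0 i).
  by move=> x Cx i; rewrite !mxE; have [_ _] := lohi i; exact.
apply/seteqP; split=> [x|x xI J [[_ [a [b ->]]] CJ] i].
  apply; split=> //; split; last by eexists; eexists.
  by exists x0; exact: Csub.
have [/CJ /(_ i)/andP[ai _] /CJ /(_ i)/andP[_ bi] _] := lohi i.
have := xI i; rewrite !mxE => /andP[xlo xhi].
by rewrite (le_trans ai xlo) (le_trans xhi bi).
Qed.

Theorem corollary3p10 (R : realType) (C : set 'rV[R]_2)
    (C_neq0 : C !=set0) (C_compact : compact C)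
    (C_convex : convex_set (C : set (convex_lmodType 'rV[R]_2))) :
  exists m : 'rV[R]_2, is_midpoint (interval_hull C) m /\ C m.
Proof.
have [lo [hi lohi]] := compact_coord_bounds C_neq0 C_compact.
have hullE := interval_hullE C_neq0 lohi.
set a := \row_i lo i 0 i in hullE; set b := \row_i hi i 0 i in hullE.
pose m := 2^-1 *: (a + b).
exists m; split.
  split; last by exists a, b.
  by have [x Cx] := C_neq0; exists x => J [_ CJ]; exact: CJ.
have mE i : m 0 i = 2^-1 * (lo i 0 i + hi i 0 i) by rewrite !mxE.
have [Cl0 Ch0 b0] := lohi 0; have [Cl1 Ch1 b1] := lohi 1.
(* Taking [e] to be [1] or [-1] treats the upper and the lower side at once. *)
have axis e s : C s ->
    (forall w, C w -> `|e * (w 0 1 - m 0 1)| <= e * (s 0 1 - m 0 1)) ->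
    exists z, [/\ C z, z 0 0 = m 0 0 & 0 <= e * (z 0 1 - m 0 1)].
  move=> Cs sdom; have /andP[ls sh] := b0 s Cs.
  (* The partner of [s] is an extreme point on the opposite side: its distance to the axis is half
     the width of the hull, so [s] is no farther. *)
  have [sm|sm] := leP (s 0 0) (m 0 0).
    apply: (@convex_axis_point _ _ _ s (hi 0)) => //; last exact: sdom.
      by move: sm; rewrite mE => sm; nra.
    by move: sm; rewrite mE => sm; rewrite ler0_norm ?ger0_norm; lra.
  apply: (@convex_axis_point _ _ _ s (lo 0)) => //; last exact: sdom.
    by move: sm; rewrite mE => sm; nra.
  by move: sm; rewrite mE => sm; rewrite ger0_norm ?ler0_norm; lra.
(* [hi 1] lies half the height of the hull above the center, which bounds the vertical offset of
   every point of [C]. *)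
have [w Cw|y [Cy y0 y1]] := axis 1 (hi 1) Ch1.
  by have /andP[lw wh] := b1 w Cw; rewrite mE !mul1r ler_norml; lra.
have [w Cw|x [Cx x0 x1]] := axis (-1) (lo 1) Cl1.
  by have /andP[lw wh] := b1 w Cw; rewrite mE !mulN1r normrN ler_norml; lra.
have neq1 (k : 'I_2) : k != 1 -> k = 0.
  by case: k => -[|[|//]] // k2 _; exact/val_inj.
apply: (@convex_between _ _ _ x y m 1) => // [k /neq1 ->|k /neq1 ->|] //.
by lra.
Qed.
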